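(* Let $\alpha>0$ and $\beta\in\mathbb{R}$ be constants and let $\Omega=(0,1)$ carry the uniform mesh with $N$ cells and mesh size $h=1/N$. For every polynomial degree $k>0$ there exists a value $\tau_k>0$ (depending on $k$, $h$, $\alpha$, $\beta$) such that the $\mathrm{HDG}_k$ method with stabilization parameter $\tau=\tau_k$ is equivalent to the Scharfetter--Gummel finite volume scheme on the dual grid; that is, for every constant source term $f\in\mathbb{R}$ and all Dirichlet boundary values $u_0(0),u_0(1)\in\mathbb{R}$, the trace $\hat u^h$ of the $\mathrm{HDG}_k$ solution and the Scharfetter--Gummel solution $(v_i)_{i=0}^N$ satisfy $\hat u^h(x_i)=v_i$ for every $i\in\{0,\dots,N\}$.
   Context: The model problem on $\Omega=(0,1)$, with constants $\alpha>0$ and $\beta,f\in\mathbb{R}$, is $J+\alpha u'-\beta u=0$, $J'=f$ in $\Omega$, with $u(0)=u_0(0)$, $u(1)=u_0(1)$. Mesh: $x_i=i/N$ for $i=0,\dots,N$, $h=1/N$, cells $T_i=(x_{i-1},x_i)$, $\mathcal{T}=\{T_1,\dots,T_N\}$. For $T\in\mathcal{T}$ let $\nu$ be the outward unit normal on $\partial T$ (i.e. $-1$ at the left endpoint, $+1$ at the right endpoint). Write $(g_1,g_2)=\sum_{T}\int_T g_1g_2\,dx$ and $\langle g_1,g_2\rangle=\sum_T\sum_{x\in\partial T}g_1(x)g_2(x)$, where cell functions on $\partial T$ are evaluated by their traces from inside $T$. $\mathrm{HDG}_k$ method with stabilization parameter $\tau>0$ (constant): let $V_k$ be the space of functions whose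 restriction to each cell is a polynomial of degree at most $k$ (no continuity between cells). Find $u^h,J^h\in V_k$ and $\hat u^h:\{x_0,\dots,x_N\}\to\mathbb{R}$ with $\hat u^h(x_0)=u_0(0)$, $\hat u^h(x_N)=u_0(1)$ such that for all $w,v\in V_k$ and all $\mu:\{x_0,\dots,x_N\}\to\mathbb{R}$ with $\mu(x_0)=\mu(x_N)=0$: $$(J^h,v)-(u^h,(\alpha v)')-(\beta u^h,v)+\langle \hat u^h,\alpha v\,\nu\rangle=0,$$ $$-(J^h,w')+\langle \hat J\nu,w\rangle=(f,w),\qquad \langle \hat J\nu,\mu\rangle=0,$$ where on each $\partial T$ the numerical flux is $\hat J\nu:=J^h\nu+\tau(u^h-\hat u^h)$. Scharfetter--Gummel scheme on the dual grid: the dual grid has vertices $y_0=x_0$, $y_i=(x_{i-1}+x_i)/2$ for $1\le i\le N$, $y_{N+1}=x_N$, with dual cells $T^d_i=(y_i,y_{i+1})$, $i=0,\dots,N$, and control points (centers) $x_0,\dots,x_N$. With the Bernoulli function $B(x)=x/(e^x-1)$ (and $B(0)=1$), the scheme is: find $(v_i)_{i=0}^N$ with $v_0=u_0(0)$, $v_N=u_0(1)$ and, for $i=1,\dots,N-1$, $$-\frac{\alpha}{h}B\Big(-\frac{\beta h}{\alpha}\Big)v_{i-1}+\Big[\frac{\alpha}{h}B\Big(\frac{\beta h}{\alpha}\Big)+\frac{\alpha}{h}B\Big(-\frac{\beta h}{\alpha}\Big)\Big]v_i-\frac{\alpha}{h}B\Big(\frac{\beta h}{\alpha}\Big)v_{i+1}=h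 f.$$ *)

(* Defs.v *)
From HB Require Import structures.
From mathcomp Require Import all_boot all_order all_algebra.
From mathcomp Require Import all_classical all_reals all_analysis.

Set Implicit Arguments.
Unset Strict Implicit.
Unset Printing Implicit Defensive.

Import Order.TTheory GRing.Theory Num.Theory.
Import numFieldNormedType.Exports.

Local Open Scope classical_set_scope.
Local Open Scope ring_scope.

Section mesh.
Variables (R : realType) (N : nat).

(* The cell with index i : 'I_N is (node i, node i.+1), so that cells are
   numbered from 0. *)
Definition node (i : nat) : R := i%:R / N%:R.

(* A piecewise polynomial is given by one polynomial (in the global
   coordinate x) per cell. *)
Definition broken_poly := {ffun 'I_N -> {poly R}}.

Definition vertex_fun := {ffun 'I_N.+1 -> R}.

Definition broken_space (k : nat) (w : broken_poly) : Prop :=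
  forall i, (size (w i) <= k.+1)%N.

Definition cell_inner (g1 g2 : 'I_N -> {poly R}) : R :=
  \sum_(i < N)
    \int[lebesgue_measure]_(x in `]node i, node i.+1[) ((g1 i).[x] * (g2 i).[x]).

(* The two points of the boundary of a cell are indexed by bool: false is the
   left endpoint and true the right one. *)
Definition face_inner (g1 g2 : 'I_N -> bool -> R) : R :=
  \sum_(i < N) \sum_(b : bool) g1 i b * g2 i b.

Definition normal (b : bool) : R := if b then 1 else -1.

Definition endpoint (i : 'I_N) (b : bool) : 'I_N.+1 :=
  if b then lift ord0 i else widen_ord (leqnSn N) i.

(* A vertex function is single-valued at a vertex, whereas the trace of a
   piecewise polynomial is taken from inside the cell. *)
Definition on_faces (m : vertex_fun) (i : 'I_N) (b : bool) : R :=
  m (endpoint i b).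

Definition trace (w : broken_poly) (i : 'I_N) (b : bool) : R :=
  (w i).[node (endpoint i b)].

End mesh.

Section schemes.
Variables (R : realType) (N : nat) (alpha beta f uL uR : R).

(* \hat J \nu, the normal component of the numerical flux *)
Definition hdg_flux (tau : R) (u J : broken_poly R N) (uhat : vertex_fun R N)
    (i : 'I_N) (b : bool) : R :=
  trace J i b * normal R b + tau * (trace u i b - on_faces uhat i b).

Record hdg_solution (k : nat) (tau : R) (u J : broken_poly R N)
    (uhat : vertex_fun R N) : Prop := HDGSolution {
  hdg_u_in : broken_space k u;
  hdg_J_in : broken_space k J;
  hdg_left : uhat ord0 = uL;
  hdg_right : uhat ord_max = uR;
  hdg_constitutive : forall v : broken_poly R N, broken_space k v ->
    cell_inner J v
    - cell_inner u (fun i => (alpha *: v i)^`())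
    - cell_inner (fun i => beta *: u i) v
    + face_inner (on_faces uhat) (fun i b => alpha * trace v i b * normal R b)
    = 0;
  hdg_balance : forall w : broken_poly R N, broken_space k w ->
    - cell_inner J (fun i => (w i)^`())
    + face_inner (hdg_flux tau u J uhat) (trace w)
    = cell_inner (fun=> f%:P) w;
  hdg_continuity : forall mu : vertex_fun R N, mu ord0 = 0 -> mu ord_max = 0 ->
    face_inner (hdg_flux tau u J uhat) (on_faces mu) = 0
}.

Definition bernoulli_fun (x : R) : R :=
  if x == 0 then 1 else x / (expR x - 1).

(* The unknown v i sits at the control point x_i of the dual cell number i; the
   right-hand side is f times the length h of an interior dual cell. *)
Record sg_solution (v : vertex_fun R N) : Prop := SGSolution {
  sg_left : v ord0 = uL;
  sg_right : v ord_max = uR;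
  sg_balance : forall i : 'I_N.+1, (0 < i < N)%N ->
    let h := N%:R^-1 : R in
    let Bp := bernoulli_fun (beta * h / alpha) in
    let Bm := bernoulli_fun (- (beta * h / alpha)) in
    - (alpha / h * Bm * v (inord i.-1))
    + (alpha / h * Bp + alpha / h * Bm) * v i
    - alpha / h * Bp * v (inord i.+1) = h * f
}.

End schemes.

(* Main.v *)
(** The discretization reproduces the nodal values of the exact solution, and so
does the Scharfetter-Gummel scheme when the source is constant.

On a reference cell [0, h] let [L_k] be the shifted Legendre polynomial. The
balance equation forces [J = j + f x - d L_k], because [L_k'] represents
[w |-> w(h) - (-1)^k w(0)] on polynomials of degree at most [k]; the numerical
flux at a point x of the boundary is then exactly [j + f x], so that continuity
makes [j] grow by [f h] from one cell to the next. The constitutive equation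
says that [U = u - (d / tau) L_(k+1)] takes the values of the trace at both
endpoints and solves [alpha U' - beta U = - j - f x + d (L_k + (beta / tau) L_(k+1))].
Integrating against [exp (- beta x / alpha)] relates the two traces, and the
relation is the exact one as soon as
[\int exp (- beta x / alpha) (L_k + (beta / tau) L_(k+1)) = 0],
which determines [tau] if [beta <> 0] and holds for every [tau] otherwise. By
Rodrigues' formula, [\int exp (- beta x / alpha) L_k] has the sign of
[(- beta)^k], whence [tau > 0].
Eliminating [j] between two consecutive cells gives the Scharfetter-Gummel
scheme. *)
Require Import Defs.
From HB Require Import structures.
From mathcomp Require Import all_boot all_order all_algebra.
From mathcomp Require Import all_classical all_reals all_analysis.
From mathcomp Require Import ring.
Import Order.TTheory GRing.Theory Num.Theory.
Import numFieldNormedType.Exports.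
Local Open Scope ring_scope.
Set Implicit Arguments.
Unset Strict Implicit.
Unset Printing Implicit Defensive.

(** * Integration of polynomials through formal primitives *)

Section polynomial_integral.
Variable R : realType.
Implicit Types (p q : {poly R}) (a b x : R).

Definition primp p : {poly R} := \poly_(i < (size p).+1) (p`_i.-1 / i%:R).

(* The constant coefficient is p`_0 / 0 = 0. *)
Lemma coef_primp p i : (primp p)`_i = p`_i.-1 / i%:R.
Proof.
rewrite coef_poly; case: ltnP => // hi.
by rewrite nth_default ?mul0r// -ltnS (leq_trans hi) // leqSpred.
Qed.

Lemma primp_is_linear : linear primp.
Proof.
move=> c p q; apply/polyP => i.
by rewrite !(coefD, coefZ, coef_primp) mulrDl mulrA.
Qed.

HB.instance Definition _ :=
  GRing.isLinear.Build R {poly R} {poly R} _ primp primp_is_linear.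

Lemma deriv_primp p : (primp p)^`() = p.
Proof.
apply/polyP => i; rewrite coef_deriv coef_primp /= -[LHS]mulr_natr.
by rewrite mulfVK ?pnatr_eq0.
Qed.

Lemma primp_deriv p : primp p^`() = p - (p`_0)%:P.
Proof.
apply/polyP => -[|i]; rewrite coefB coefC coef_primp /=.
  by rewrite invr0 mulr0 subrr.
by rewrite subr0 coef_deriv -[X in X / _]mulr_natr mulfK// pnatr_eq0.
Qed.

(** An algebraic integral, so that linearity and integration by parts stay inside polynomial
    algebra; [integral_poly] ties it to the Lebesgue integral. *)
Definition pint a b p : R := (primp p).[b] - (primp p).[a].

Lemma pint_is_linear a b : linear_for *%R (pint a b).
Proof.
move=> c p q; rewrite /pint linearP !hornerD !hornerZ.
by rewrite opprD addrACA mulrBr.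
Qed.

HB.instance Definition _ a b :=
  GRing.isLinear.Build R {poly R} R _ (pint a b) (pint_is_linear a b).

Lemma pintD a b p q : pint a b (p + q) = pint a b p + pint a b q.
Proof. exact: linearD. Qed.

Lemma pintB a b p q : pint a b (p - q) = pint a b p - pint a b q.
Proof. exact: linearB. Qed.

Lemma pintZ a b c p : pint a b (c *: p) = c * pint a b p.
Proof. exact: linearZ. Qed.

Lemma pint_deriv a b p : pint a b p^`() = p.[b] - p.[a].
Proof. by rewrite /pint primp_deriv !hornerD !hornerN !hornerC; ring. Qed.

Lemma pint_by_parts a b p q :
  pint a b (p^`() * q) = p.[b] * q.[b] - p.[a] * q.[a] - pint a b (p * q^`()).
Proof.
apply/eqP; rewrite eq_sym subr_eq eq_sym -raddfD /= -derivM pint_deriv.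
by rewrite !hornerM.
Qed.

Lemma horner_compXaddC p a x : (p \Po ('X + a%:P)).[x] = p.[x + a].
Proof. by rewrite horner_comp !hornerE. Qed.

Lemma deriv_compXaddC p a : (p \Po ('X + a%:P))^`() = p^`() \Po ('X + a%:P).
Proof. by rewrite deriv_comp derivD derivX derivC addr0 mulr1. Qed.

Lemma size_compXaddC p a : size (p \Po ('X + a%:P)) = size p.
Proof. by rewrite size_comp_poly2 // size_XaddC. Qed.

Lemma compXaddCK a p : (p \Po ('X - a%:P)) \Po ('X + a%:P) = p.
Proof.
by rewrite -comp_polyA comp_polyB comp_polyX comp_polyC addrK comp_polyXr.
Qed.

Lemma compXsubCK a p : (p \Po ('X + a%:P)) \Po ('X - a%:P) = p.
Proof.
by rewrite -comp_polyA comp_polyD comp_polyX comp_polyC subrK comp_polyXr.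
Qed.

Lemma pint_compXaddC a b p : pint 0 b (p \Po ('X + a%:P)) = pint a (b + a) p.
Proof.
by rewrite -{1}[p]deriv_primp -deriv_compXaddC pint_deriv !horner_compXaddC add0r.
Qed.

Lemma integral_poly a b p : a < b ->
  \int[lebesgue_measure]_(x in `]a, b[) p.[x] = pint a b p.
Proof.
move=> ab.
have cp : {within `[a, b], continuous (horner p)}%classic.
  by apply: continuous_subspaceT => x; exact: continuous_horner.
have ip : lebesgue_measure.-integrable `[a, b] (EFin \o horner p).
  by apply: continuous_compact_integrable => //; exact: segment_compact.
have io : lebesgue_measure.-integrable `]a, b[ (EFin \o horner p).
  by apply: integrableS ip => //; apply: subset_itv_oo_cc.
have ic : lebesgue_measure.-integrable `[a, b[ (EFin \o horner p).
  by apply: integrableS ip => //; apply: subset_itv_co_cc.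
(* The endpoints are null sets, so the fundamental theorem applies on the closed interval. *)
rewrite Rintegral_itv_obnd_cbnd// Rintegral_itv_bndo_bndc// /Rintegral.
rewrite (@continuous_FTC2 _ _ (horner (primp p)) _ _ ab cp).
- by [].
- split; first by move=> x _; exact: derivable_horner.
  + by apply: cvg_at_right_filter; exact: continuous_horner.
  + by apply: cvg_at_left_filter; exact: continuous_horner.
- move=> x _; rewrite derive1E (@derive_val _ _ _ _ _ _ _ (is_derive_poly _ _)).
  by rewrite deriv_primp.
Qed.

(** The primitive [F] of p^2 is nondecreasing by the mean value theorem; equal values at 0 and [b]
    make it constant on [0, b], hence constant as a polynomial, so p^2 = 0. *)
Lemma pint_sqr_eq0 b p : 0 < b -> pint 0 b (p * p) = 0 -> p = 0.
Proof.
move=> b0 pp0; set F := primp (p * p).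
have mono x y : x <= y -> F.[x] <= F.[y].
  rewrite le_eqVlt => /predU1P[->//|xy].
  have dF c : is_derive c (1 : R) (horner F) (p * p).[c].
    by rewrite -[p * p]deriv_primp; exact: is_derive_poly.
  have cF : {within `[x, y], continuous (horner F)}%classic.
    by apply: continuous_subspaceT => c; exact: continuous_horner.
  have [c _ Fxy] := MVT xy (fun c _ => dF c) cF.
  rewrite -subr_ge0 Fxy hornerM mulr_ge0//; last by rewrite subr_ge0 ltW.
  by rewrite -expr2 sqr_ge0.
have F0 x : 0 <= x <= b -> root (F - (F.[0])%:P) x.
  case/andP => x0 xb; rewrite rootE !hornerE subr_eq0; apply/eqP/le_anti.
  rewrite [X in _ && X]mono// andbT (le_trans (mono _ _ xb))//.
  by rewrite -subr_le0 -/(pint 0 b (p * p)) pp0.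
suff /polyP Fc : F - (F.[0])%:P = 0.
  have : (F - (F.[0])%:P)^`() = 0.
    by apply/polyP => i; rewrite coef_deriv Fc coef0 mul0rn coef0.
  rewrite derivB derivC subr0 deriv_primp => /eqP.
  by rewrite mulf_eq0 orbb => /eqP.
apply/eqP/negPn/negP => nz.
(* Distinct points of [0, b], one more than a nonzero polynomial of that size can have as roots. *)
pose s := [seq b / i.+1%:R | i <- iota 0 (size (F - (F.[0])%:P))].
suff: (size s < size (F - (F.[0])%:P)%R)%N by rewrite size_map size_iota ltnn.
apply: max_poly_roots nz _ _.
- apply/allP => _ /mapP[i _ ->]; apply: F0.
  rewrite divr_ge0 ?ler0n ?(ltW b0)//= ler_pdivrMr ?ltr0n//.
  by rewrite ler_peMr ?(ltW b0)// ler1n.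
- rewrite map_inj_uniq ?iota_uniq// => i j /(mulfI (lt0r_neq0 b0))/invr_inj.
  by move=> /eqP; rewrite eqr_nat => /eqP[].
Qed.

Lemma pint_nondegenerate b p n : 0 < b -> (size p <= n)%N ->
  (forall q, (size q <= n)%N -> pint 0 b (p * q) = 0) -> p = 0.
Proof. by move=> b0 sp pq; apply: (pint_sqr_eq0 b0); exact: pq. Qed.

End polynomial_integral.

(** * Shifted Legendre polynomials on [0, h] by Rodrigues' formula *)

Definition bubble (R : realType) (h : R) : {poly R} := 'X * ('X - h%:P).

(* Locked, lest lemmas on scaled polynomials see through it. *)
HB.lock Definition legendre (R : realType) (h : R) (k : nat) : {poly R} :=
  (k`!%:R * h ^+ k)^-1 *: (bubble h ^+ k)^`(k).

Section shifted_legendre.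
Variables (R : realType) (h : R).
Hypothesis h_gt0 : 0 < h.
Implicit Types (p q v : {poly R}) (k j : nat).

Lemma derivn_compXaddC p a n :
  (p \Po ('X + a%:P))^`(n) = p^`(n) \Po ('X + a%:P).
Proof. by elim: n => // n IH; rewrite !derivnS IH deriv_compXaddC. Qed.

(** Taylor's formula: derivatives at an endpoint are read off the polynomial recentred there, where
    powers of [bubble] show an explicit factor X^k. *)
Lemma horner_derivn p a n : p^`(n).[a] = (p \Po ('X + a%:P))`_n *+ n`!.
Proof.
have -> : p^`(n).[a] = ((p \Po ('X + a%:P))^`(n)).[0].
  by rewrite derivn_compXaddC horner_compXaddC add0r.
by rewrite horner_coef0 coef_derivn addn0 ffactnn.
Qed.

Lemma size_deriv_leq p n : (size p <= n.+1)%N -> (size p^`() <= n)%N.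
Proof.
by move/leq_sizeP => pn; apply/leq_sizeP => i ni; rewrite coef_deriv pn ?mul0rn.
Qed.

Local Notation bubble := (bubble h).
Local Notation legendre := (legendre h).

Lemma bubble_right k :
  bubble ^+ k \Po ('X + h%:P) = ('X + h%:P) ^+ k * 'X^k.
Proof.
rewrite rmorphXn /= -exprMn; congr (_ ^+ k).
by rewrite /bubble comp_polyM comp_polyB comp_polyC comp_polyX addrK.
Qed.

Lemma bubble_left k :
  bubble ^+ k \Po ('X + 0%:P) = ('X - h%:P) ^+ k * 'X^k.
Proof. by rewrite addr0 comp_polyXr /bubble exprMn mulrC. Qed.

Lemma derivn_bubble0 k j : (j < k)%N -> (bubble ^+ k)^`(j).[0] = 0.
Proof. by move=> jk; rewrite horner_derivn bubble_left coefMXn jk mul0rn. Qed.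

Lemma derivn_bubbleh k j : (j < k)%N -> (bubble ^+ k)^`(j).[h] = 0.
Proof. by move=> jk; rewrite horner_derivn bubble_right coefMXn jk mul0rn. Qed.

Let scale_gt0 k : 0 < k`!%:R * h ^+ k.
Proof. by rewrite mulr_gt0 ?exprn_gt0// ltr0n fact_gt0. Qed.

Lemma legendre_right k : (legendre k).[h] = 1.
Proof.
rewrite legendre.unlock hornerZ horner_derivn bubble_right coefMXn ltnn subnn.
rewrite -horner_coef0.
rewrite horner_exp !hornerE -[X in _ * X]mulr_natl mulVf//.
by rewrite gt_eqF.
Qed.

Lemma legendre_left k : (legendre k).[0] = (-1) ^+ k.
Proof.
rewrite legendre.unlock hornerZ horner_derivn bubble_left coefMXn ltnn subnn.
rewrite -horner_coef0.
rewrite horner_exp !hornerE (exprNn h) -[X in _ * X]mulr_natl.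
have s0 : k`!%:R * h ^+ k != 0 by rewrite gt_eqF.
by apply: (mulfI s0); rewrite mulVKf//; ring.
Qed.

Lemma size_bubbleX k : size (bubble ^+ k) = k.*2.+1.
Proof.
have sb : size bubble = 3.
  by rewrite /bubble mulrC size_mulX ?polyXsubC_eq0// size_XsubC.
have bn0 : bubble ^+ k != 0 by rewrite expf_neq0// -size_poly_gt0 sb.
by rewrite -(prednK (_ : 0 < size (bubble ^+ k)))%N ?size_poly_gt0// size_exp sb mul2n.
Qed.

Lemma size_legendre k : (size (legendre k) <= k.+1)%N.
Proof.
rewrite legendre.unlock; apply: leq_trans (size_scale_leq _ _) _.
apply/leq_sizeP => i ki; rewrite coef_derivn nth_default ?mul0rn//.
by rewrite size_bubbleX -addnn -addnS leq_add2l.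
Qed.

(** Decides the coefficient of degree k + 1 in the local problem when beta = 0. *)
Lemma legendre_lead_gt0 k : 0 < (legendre k)`_k.
Proof.
rewrite legendre.unlock coefZ coef_derivn mulr_gt0 ?invr_gt0//.
have -> : (bubble ^+ k)`_(k + k) = 1.
  have /monicP <- : bubble ^+ k \is monic.
    by rewrite monic_exp// monicMl ?monicX// monicXsubC.
  by rewrite lead_coefE size_bubbleX addnn.
by rewrite pmulrn_lgt0 ?ltr01// ffact_gt0 leq_addr.
Qed.

Lemma legendre_orthogonal k v : (size v <= k)%N -> pint 0 h (legendre k * v) = 0.
Proof.
move=> sv; rewrite legendre.unlock -scalerAl linearZ /=.
(* Each integration by parts moves one derivative onto [w] and lowers its degree; the boundary terms
   vanish because the bubble power has zeros of order k at both ends. *)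
suff main m (w : {poly R}) : (m <= k)%N -> (size w <= m)%N ->
    pint 0 h ((bubble ^+ k)^`(m) * w) = 0 by rewrite main ?mulr0.
elim: m w => [|m IH] w mk sw.
  by move: sw; rewrite leqn0 size_poly_eq0 => /eqP ->; rewrite mulr0 linear0.
rewrite derivnS pint_by_parts derivn_bubble0 ?derivn_bubbleh// !mul0r IH ?subrr//.
  exact: ltnW.
exact: size_deriv_leq.
Qed.

(** After integration by parts the volume term vanishes by orthogonality to v'. This turns the
    boundary terms of the method into volume terms. *)
Lemma pint_deriv_legendre k v : (size v <= k.+1)%N ->
  pint 0 h ((legendre k)^`() * v) = v.[h] - (-1) ^+ k * v.[0].
Proof.
move=> sv; rewrite pint_by_parts legendre_right legendre_left mul1r.
by rewrite legendre_orthogonal ?subr0// size_deriv_leq.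
Qed.

(** The bubble is symmetric about h / 2 and each derivative contributes a sign. Serves to reduce
    beta < 0 to beta > 0. *)
Lemma legendre_reflect k : legendre k \Po (h%:P - 'X) = (-1) ^+ k *: legendre k.
Proof.
have derivn_reflect p n :
    (p \Po (h%:P - 'X))^`(n) = (-1) ^+ n *: (p^`(n) \Po (h%:P - 'X)).
  elim: n => [|n IH]; first by rewrite !derivn0 scale1r.
  rewrite !derivnS IH derivZ deriv_comp derivB derivC derivX sub0r mulrN1.
  by rewrite scalerN -scaleNr exprS mulN1r.
have sym : bubble ^+ k \Po (h%:P - 'X) = bubble ^+ k.
  rewrite rmorphXn /=; congr (_ ^+ k).
  rewrite /bubble comp_polyM comp_polyB comp_polyC comp_polyX; ring.
rewrite !legendre.unlock comp_polyZ scalerA [(-1) ^+ k * _]mulrC -scalerA; congr (_ *: _).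
by rewrite -[in RHS]sym derivn_reflect scalerA -exprMn mulrNN mulr1 expr1n scale1r.
Qed.

(** Recentred at [h] the bubble is X (X + h), and nonnegative coefficients survive powers and
    derivatives. *)
Lemma legendre_nneg k : legendre k \Po ('X + h%:P) \is a polyOver Num.nneg.
Proof.
rewrite legendre.unlock comp_polyZ -derivn_compXaddC bubble_right polyOverZ//.
  by rewrite nnegrE invr_ge0 ltW.
rewrite polyOver_derivn// rpredM ?rpredX// ?polyOverX// rpredD ?polyOverX//.
by rewrite polyOverC nnegrE ltW.
Qed.

End shifted_legendre.

(** * The operator alpha Q' - beta Q and the choice of the stabilization *)

Section drift_diffusion.
Variables (R : realType) (h alpha : R).
Hypotheses (h_gt0 : 0 < h) (alpha_gt0 : 0 < alpha).
Implicit Types (p q g w Q : {poly R}) (beta : R).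

Definition drift beta Q : {poly R} := alpha *: Q^`() - beta *: Q.

Lemma drift_is_linear beta : linear (drift beta).
Proof.
move=> c p q; rewrite /drift derivD derivZ !scalerDr !scalerN !scalerA.
by rewrite opprD addrACA [alpha * c]mulrC [beta * c]mulrC.
Qed.

HB.instance Definition _ beta :=
  GRing.isLinear.Build R {poly R} {poly R} _ (drift beta) (drift_is_linear beta).

Lemma driftD beta p q : drift beta (p + q) = drift beta p + drift beta q.
Proof. exact: linearD. Qed.

Lemma driftB beta p q : drift beta (p - q) = drift beta p - drift beta q.
Proof. exact: linearB. Qed.

Lemma driftZ beta c p : drift beta (c *: p) = c *: drift beta p.
Proof. exact: linearZ. Qed.

Lemma deriv_drift beta Q : (drift beta Q)^`() = drift beta Q^`().
Proof. by rewrite derivB !derivZ. Qed.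

(** The leading coefficient of [Q] survives, multiplied by - beta. *)
Lemma size_drift beta Q : beta != 0 -> (size Q <= size (drift beta Q))%N.
Proof.
move=> b0; have [->|Q0] := eqVneq Q 0; first by rewrite size_poly0.
rewrite leqNgt; apply/negP => lt.
have /leq_sizeP/(_ _ (leqnn _)) : (size (drift beta Q) <= (size Q).-1)%N.
  by rewrite -ltnS prednK ?size_poly_gt0.
rewrite coefB !coefZ coef_deriv prednK ?size_poly_gt0// nth_default//.
rewrite mul0rn mulr0 sub0r => /eqP; rewrite oppr_eq0 mulf_eq0 (negPf b0) /=.
by rewrite -lead_coefE lead_coef_eq0 (negPf Q0).
Qed.

Lemma drift_eq0 beta Q : beta != 0 -> drift beta Q = 0 -> Q = 0.
Proof.
move=> b0 dQ; apply/eqP; rewrite -size_poly_leq0.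
by apply: leq_trans (size_drift Q b0) _; rewrite dQ size_poly0.
Qed.

(** For beta = 0, take a primitive. Otherwise - g / beta is a solution up to a multiple of g', and
    induction on the degree corrects it. *)
Lemma drift_surjective beta g : exists Q, drift beta Q = g.
Proof.
have [->|b0] := eqVneq beta 0.
  exists (alpha^-1 *: primp g); rewrite /drift scale0r subr0 derivZ deriv_primp.
  by rewrite scalerA mulfV ?scale1r// gt_eqF.
have [n] := ubnP (size g); elim: n g => // n IH g sg.
have [->|g0] := eqVneq g 0; first by exists 0; rewrite linear0.
have [|Q dQ] := IH (beta^-1 *: (alpha *: g^`())).
  apply: leq_ltn_trans (size_scale_leq _ _) _.
  apply: leq_ltn_trans (size_scale_leq _ _) _.
  exact: leq_trans (lt_size_deriv g0) sg.
exists (Q - beta^-1 *: g); rewrite linearB /= dQ /drift derivZ.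
rewrite !scalerA [alpha / beta]mulrC mulfV// scale1r -!scalerA.
by rewrite scalerA mulrC -scalerA opprB addrC subrK.
Qed.

(* The jump over the cell of exp (- beta x / alpha) Q x, whose derivative is a
   positive multiple of drift beta Q. *)
Definition expjump beta Q : R :=
  expR (- (beta / alpha * h)) * Q.[h] - Q.[0].

Lemma expjump_is_linear beta : linear_for *%R (expjump beta).
Proof. by move=> c p q; rewrite /expjump !hornerD !hornerZ; ring. Qed.

HB.instance Definition _ beta :=
  GRing.isLinear.Build R {poly R} R _ (expjump beta) (expjump_is_linear beta).

Lemma expjumpD beta p q : expjump beta (p + q) = expjump beta p + expjump beta q.
Proof. exact: linearD. Qed.

Lemma expjumpB beta p q : expjump beta (p - q) = expjump beta p - expjump beta q.
Proof. exact: linearB. Qed.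

Lemma expjumpZ beta c p : expjump beta (c *: p) = c * expjump beta p.
Proof. exact: linearZ. Qed.

(** The mean value theorem applied to exp (- beta x / alpha) Q x lets the sign of [drift beta Q]
    control the jump without integrating exponentials. *)
Lemma expjump_mean_value beta Q : exists c r,
  [/\ 0 < c < h, 0 < r & expjump beta Q = r * (drift beta Q).[c]].
Proof.
pose s := - (beta / alpha).
pose E : R -> R := expR \o ( *%R s).
pose F : R -> R := E * horner Q.
have dF c : is_derive c (1 : R) F (E c *: Q^`().[c] + Q.[c] *: (E c * s)).
  apply: is_deriveM.
  apply: is_derive1_comp.
  have : is_derive c (1 : R) (s *: (@id R)) (s *: (1 : R)) by apply: is_deriveZ.
  by rewrite /GRing.scale /= mulr1.
have cF : {within `[0, h], continuous F}%classic.
  apply: continuous_subspaceT => c; apply: differentiable_continuous.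
  by apply/derivable1_diffP; case: (dF c).
have [c ch] := MVT h_gt0 (fun c _ => dF c) cF.
rewrite subr0 => Fh; exists c, (E c * h / alpha); split.
- by move: ch; rewrite in_itv.
- by rewrite divr_gt0// mulr_gt0// expR_gt0.
have -> : expjump beta Q = F h - F 0.
  by rewrite /F /E /= !fctE /= mulr0 expR0 mul1r /expjump mulNr.
rewrite Fh /drift /s hornerD hornerN !hornerZ /GRing.scale /=.
by field; rewrite gt_eqF.
Qed.

Lemma expjump_gt0 beta Q : (forall c, 0 < c < h -> 0 < (drift beta Q).[c]) ->
  0 < expjump beta Q.
Proof.
by move=> Q0; have [c [r [ch r0 ->]]] := expjump_mean_value beta Q; rewrite mulr_gt0// Q0.
Qed.

Lemma expjump_eq0 beta Q : drift beta Q = 0 -> expjump beta Q = 0.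
Proof.
move=> Q0; have [c [r [_ _ ->]]] := expjump_mean_value beta Q.
by rewrite Q0 horner0 mulr0.
Qed.

(** The jump depends on [drift beta Q] alone: it is the integral of exp (- beta x / alpha) against
    it, divided by alpha. *)
Lemma expjump_eq beta p q : drift beta p = drift beta q ->
  expjump beta p = expjump beta q.
Proof.
move=> pq; apply/eqP; rewrite -subr_eq0; apply/eqP.
have /expjump_eq0 : drift beta (p - q) = 0 by rewrite linearB /= pq subrr.
by rewrite linearB.
Qed.

(* Integrating by parts k times, exp (- beta x / alpha) has the same sign
   against the k-th Legendre polynomial as against (x (h - x)) ^ k. *)
Lemma legendre_primitive beta k : 0 < beta -> exists A,
  drift beta A = legendre h k /\ 0 < (-1) ^+ k * expjump beta A.
Proof.
move=> b0; have [Q dQ] := drift_surjective beta (bubble h ^+ k).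
have dQn j : drift beta Q^`(j) = (bubble h ^+ k)^`(j).
  by elim: j => // j IH; rewrite !derivnS -deriv_drift IH.
(* For j < k the j-th derivative of the bubble power vanishes at both ends, so there alpha Q^(j+1) =
   beta Q^(j). *)
have jump j : (j <= k)%N ->
    expjump beta Q^`(j) = (beta / alpha) ^+ j * expjump beta Q.
  elim: j => [|j IH] jk; first by rewrite mul1r.
  have dj x : alpha * Q^`(j.+1).[x] = beta * Q^`(j).[x] + (bubble h ^+ k)^`(j).[x].
    by rewrite -dQn derivnS !(hornerD, hornerN, hornerZ) addrC subrK.
  have := dj 0; have := dj h; rewrite derivn_bubble0// derivn_bubbleh// !addr0.
  move=> djh dj0; rewrite exprS -mulrA -IH; last exact: ltnW.
  apply: (mulfI (lt0r_neq0 alpha_gt0)); rewrite /expjump.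
  rewrite mulrBr mulrCA djh dj0; field.
  by rewrite gt_eqF.
have Qk : 0 < (-1) ^+ k * expjump beta Q.
  have <- : expjump beta ((-1) ^+ k *: Q) = (-1) ^+ k * expjump beta Q.
    by rewrite linearZ.
  apply: expjump_gt0 => c /andP[c0 ch].
  rewrite linearZ /= dQ hornerZ horner_exp -exprMn exprn_gt0// /bubble !hornerE.
  by rewrite /= mulN1r mulNr -mulrN opprB mulr_gt0// subr_gt0.
have s0 : 0 < (k`!%:R * h ^+ k)^-1.
  by rewrite invr_gt0 mulr_gt0 ?exprn_gt0// ltr0n fact_gt0.
exists ((k`!%:R * h ^+ k)^-1 *: Q^`(k)); split.
  by rewrite legendre.unlock linearZ /= dQn.
rewrite linearZ /= jump// mulrCA mulr_gt0//.
by rewrite mulrCA mulr_gt0// exprn_gt0// divr_gt0.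
Qed.

(** Since - w = (alpha (- w') + g) / beta, induct on the degree: w' solves the equation with
    right-hand side g'. *)
Lemma drift_nneg beta g w : 0 < beta -> drift beta w = g ->
  g \Po ('X + h%:P) \is a polyOver Num.nneg ->
  - w \Po ('X + h%:P) \is a polyOver Num.nneg.
Proof.
move=> b0; have [n] := ubnP (size w); elim: n w g => // n IH w g sw dw g0.
have [->|w0] := eqVneq w 0; first by rewrite oppr0 comp_poly0 polyOver0.
have Nw : - w = beta^-1 *: (alpha *: (- w^`()) + g).
  rewrite -dw /drift addrA scalerN addNr add0r scalerN scalerA mulVf ?scale1r//.
  by rewrite gt_eqF.
rewrite Nw comp_polyZ polyOverZ// ?nnegrE ?invr_ge0 ?ltW// comp_polyD rpredD//.
rewrite comp_polyZ polyOverZ// ?nnegrE ?ltW//.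
apply: (IH _ g^`()); first exact: leq_trans (lt_size_deriv w0) sw.
  by rewrite -deriv_drift dw.
by rewrite -deriv_compXaddC polyOver_deriv.
Qed.

(** At [h], beta w = alpha w' - g, where w' is nonpositive by [drift_nneg] and g is positive. *)
Lemma drift_lt0 beta g w : 0 < beta -> drift beta w = g ->
  g \Po ('X + h%:P) \is a polyOver Num.nneg -> 0 < g.[h] -> w.[h] < 0.
Proof.
move=> b0 dw gnn gh.
have : 0 <= (- w^`()).[h].
  have /polyOverP/(_ 0) : - w^`() \Po ('X + h%:P) \is a polyOver Num.nneg.
    apply: (drift_nneg b0 (erefl _)).
    by rewrite -deriv_drift dw -deriv_compXaddC polyOver_deriv.
  by rewrite nnegrE -horner_coef0 horner_compXaddC add0r.
rewrite hornerN oppr_ge0 => w'0.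
rewrite -(pmulr_rlt0 _ b0) -[_ < 0]oppr_gt0.
have := gh; rewrite -dw hornerD hornerN !hornerZ => /lt_le_trans; apply.
by rewrite gerDr pmulr_rle0.
Qed.

(** The jumps of the primitives of L_k and L_(k+1) have opposite signs, so a positive weight beta /
    tau cancels them. The zero jump gives w(0) = exp (- beta h / alpha) w(h), and w(h) < 0 by
    [drift_lt0]. *)
Lemma exact_stabilization_pos beta k : 0 < beta -> exists tau w,
  [/\ 0 < tau, drift beta w = legendre h k + (beta / tau) *: legendre h k.+1,
      expjump beta w = 0 & w.[0] != 0].
Proof.
move=> b0.
have [A [dA EA]] := legendre_primitive k b0.
have [B [dB EB]] := legendre_primitive k.+1 b0.
set a := (-1) ^+ k * _ in EA; set b := (-1) ^+ k.+1 * _ in EB.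
pose tau := beta * b / a.
have tauE : beta / tau = a / b.
  by rewrite /tau; field; rewrite !gt_eqF.
have t0 : 0 < tau by rewrite divr_gt0// mulr_gt0.
exists tau, (A + (beta / tau) *: B).
have dw : drift beta (A + (beta / tau) *: B) =
    legendre h k + (beta / tau) *: legendre h k.+1.
  by rewrite linearD linearZ /= dA dB.
have Ew : expjump beta (A + (beta / tau) *: B) = 0.
  rewrite linearD linearZ /= tauE.
  apply: (mulfI (_ : (-1) ^+ k != 0)); first by rewrite signr_eq0.
  rewrite mulr0 mulrDr -/a; have -> : expjump beta B = - ((-1) ^+ k * b).
    by rewrite /b exprS mulN1r !mulNr mulrN opprK mulrA -exprMn mulrNN mulr1 expr1n mul1r.
  have : b != 0 by rewrite gt_eqF.
  have : (-1 : R) ^+ k * (-1) ^+ k = 1 by rewrite -exprMn mulrNN mulr1 expr1n.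
  move=> e bn0.
  transitivity (a - (-1) ^+ k * (-1) ^+ k * (a / b * b)); first by ring.
  by rewrite e mul1r mulfVK// subrr.
split=> //.
have wh : (A + (beta / tau) *: B).[h] < 0.
  apply: (drift_lt0 b0 dw).
    have /polyOverP Lk := legendre_nneg h_gt0 k.
    have /polyOverP Lk1 := legendre_nneg h_gt0 k.+1.
    rewrite comp_polyD (comp_polyZ (beta / tau)); apply/polyOverP => i.
    rewrite coefD coefZ nnegrE addr_ge0//; first exact: Lk.
    by rewrite mulr_ge0//; [exact/ltW/divr_gt0 | exact: Lk1].
  by rewrite hornerD hornerZ !legendre_right// addr_gt0// mulr1 divr_gt0.
apply/negP => /eqP w0; move: Ew; rewrite /expjump w0 subr0 => /eqP.
by rewrite mulf_eq0 (lt_eqF wh) gt_eqF// expR_gt0.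
Qed.

(** The nonvanishing of w(0) will determine the coefficient [d] of the local solution; for beta = 0
    leading coefficients do so instead. *)
Lemma exact_stabilization beta k : (0 < k)%N -> exists tau w,
  [/\ 0 < tau, drift beta w = legendre h k + (beta / tau) *: legendre h k.+1,
      expjump beta w = 0 & beta != 0 -> w.[0] != 0].
Proof.
move=> k0; case: (ltgtP 0 beta) => [b0|b0|<-].
- have [tau [w [t0 dw Ew w0]]] := exact_stabilization_pos k b0.
  by exists tau, w.
- have [|tau [w [t0 dw Ew w0]]] := @exact_stabilization_pos (- beta) k.
    by rewrite oppr_gt0.
  have wh : w.[h] = expR (- (beta / alpha * h)) * w.[0].
    move/eqP: Ew; rewrite /expjump subr_eq0 mulNr mulNr opprK => /eqP <-.
    by rewrite mulrA -expRD addNr expR0 mul1r.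
  (* Reflecting x to h - x reverses the derivative, hence the sign of beta; the factor compensates
     this sign and the parities of L_k and L_(k+1). *)
  exists tau, ((-1) ^+ k.+1 *: (w \Po (h%:P - 'X))); split=> //.
  + have -> : drift beta ((-1) ^+ k.+1 *: (w \Po (h%:P - 'X))) =
        (-1) ^+ k *: (drift (- beta) w \Po (h%:P - 'X)).
      rewrite linearZ /= /drift deriv_comp comp_polyB !comp_polyZ.
      rewrite derivB derivC derivX sub0r mulrN1 exprS mulN1r scalerN.
      by rewrite [LHS]scaleNr -scalerN opprD !opprK [in RHS]scaleNr opprK.
    rewrite dw comp_polyD comp_polyZ !legendre_reflect// scalerDr !scalerA.
    have -> : (-1) ^+ k * (- beta / tau) * (-1) ^+ k.+1 =
        (-1) ^+ k * (-1) ^+ k * (beta / tau) by rewrite exprS; ring.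
    by rewrite -expr2 sqrr_sign mul1r scale1r.
  + rewrite linearZ /= /expjump !horner_comp !hornerE subrr ?subr0 wh.
    by rewrite subrr mulr0.
  + move=> _; rewrite hornerZ horner_comp !hornerE subr0 wh.
    by rewrite !mulf_neq0 ?signr_eq0// gt_eqF// expR_gt0.
(* Here beta = 0: any positive tau would do, and the jump of [w] vanishes since L_k is orthogonal to
   constants for k > 0. *)
exists 1, (alpha^-1 *: primp (legendre h k)); split=> //.
- rewrite /drift derivZ deriv_primp scalerA mulfV ?gt_eqF//.
  by rewrite mul0r !scale0r subr0 addr0 scale1r.
- rewrite linearZ /= /expjump mul0r mul0r oppr0 expR0 mul1r.
  rewrite -/(pint 0 h (legendre h k)) -[legendre h k]mulr1.
  by rewrite legendre_orthogonal ?mulr0// size_poly1.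
Qed.

End drift_diffusion.

(** * The equations on one cell, moved to [0, h], with the trace as data *)

Section local_problem.
Variables (R : realType) (h alpha beta tau : R) (k : nat).
Hypotheses (h_gt0 : 0 < h) (alpha_gt0 : 0 < alpha) (tau_gt0 : 0 < tau).
Hypothesis k_gt0 : (0 < k)%N.
Implicit Types (u J v w U Q p : {poly R}) (f j d uL uR : R).

Local Notation L := (legendre h).
Local Notation drift := (drift alpha beta).
Local Notation expjump := (expjump h alpha beta).

Definition flux_left u J uL : R := - J.[0] + tau * (u.[0] - uL).
Definition flux_right u J uR : R := J.[h] + tau * (u.[h] - uR).

Record local_hdg f u J uL uR : Prop := LocalHDG {
  local_u : (size u <= k.+1)%N;
  local_J : (size J <= k.+1)%N;
  local_constitutive : forall v, (size v <= k.+1)%N ->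
    pint 0 h (J * v) - pint 0 h (u * (alpha *: v)^`()) - pint 0 h (beta *: u * v)
    + alpha * (uR * v.[h] - uL * v.[0]) = 0;
  local_balance : forall w, (size w <= k.+1)%N ->
    - pint 0 h (J * w^`()) + (flux_left u J uL * w.[0] + flux_right u J uR * w.[h])
    = pint 0 h (f%:P * w)
}.

(* U is u corrected by a multiple of the Legendre polynomial of degree k + 1
   so as to take the values of the trace at both endpoints. *)
Record local_form f uL uR j d U : Prop := LocalForm {
  form_drift : drift U = d *: (L k + (beta / tau) *: L k.+1) - (j%:P + f *: 'X);
  form_left : U.[0] = uL;
  form_right : U.[h] = uR;
  form_size : (size (U + (d / tau) *: L k.+1)%R <= k.+1)%N
}.

Lemma deriv_eq0 p : p^`() = 0 -> p = (p.[0])%:P.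
Proof.
move=> p0; apply/eqP; rewrite horner_coef0 -subr_eq0 -primp_deriv p0.
by rewrite linear0.
Qed.

Let sgn2 : (-1 : R) ^+ k * (-1) ^+ k = 1.
Proof. by rewrite -expr2 sqrr_sign. Qed.

Let hn0 : h != 0. Proof. by rewrite gt_eqF. Qed.
Let an0 : alpha != 0. Proof. by rewrite gt_eqF. Qed.
Let tn0 : tau != 0. Proof. by rewrite gt_eqF. Qed.

Lemma local_hdg_form f u J uL uR : local_hdg f u J uL uR ->
  exists j d U, [/\ u = U + (d / tau) *: L k.+1,
    J = j%:P + f *: 'X - d *: L k & local_form f uL uR j d U].
Proof.
case=> su sJ cons bal.
set d := tau * (u.[h] - uR); set dL := tau * (u.[0] - uL).
have bal' w : (size w <= k.+1)%N ->
    pint 0 h (J^`() * w) + dL * w.[0] + d * w.[h] = pint 0 h (f%:P * w).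
  by move/bal => <-; rewrite pint_by_parts /flux_left /flux_right -/d -/dL; ring.
(* Testing with L_k, orthogonal to J' and f, ties the two stabilization terms together. *)
have dLE : dL = - ((-1) ^+ k * d).
  have := bal' _ (size_legendre h k); rewrite legendre_left// legendre_right//.
  rewrite [_^`() * _]mulrC legendre_orthogonal ?size_deriv_leq//.
  rewrite [f%:P * _]mulrC legendre_orthogonal//; last first.
    by rewrite (leq_trans (size_polyC_leq1 _)).
  rewrite add0r mulr1 => /eqP; rewrite addr_eq0 => /eqP e.
  transitivity (dL * (-1) ^+ k * (-1) ^+ k); first by rewrite -mulrA sgn2 mulr1.
  by rewrite e; ring.
have sLk1 : (size (L k.+1)^`() <= k.+1)%N by rewrite size_deriv_leq// size_legendre.
(* By [dLE] the boundary terms are the pairing with d L_k'; the residual has degree at most k and is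
   orthogonal to all test functions. *)
have dJ : J^`() + d *: (L k)^`() - f%:P = 0.
  apply: (pint_nondegenerate h_gt0 (n := k.+1)).
    rewrite (leq_trans (size_polyD _ _))// geq_max size_polyN.
    rewrite (leq_trans (size_polyC_leq1 _))// andbT.
    rewrite (leq_trans (size_polyD _ _))// geq_max.
    rewrite (leq_trans (size_deriv_leq (leqW sJ)))//=.
    rewrite (leq_trans (size_scale_leq _ _))//.
    by rewrite size_deriv_leq// leqW// size_legendre.
  move=> w sw; rewrite mulrBl mulrDl -scalerAl pintB pintD pintZ.
  rewrite pint_deriv_legendre// -bal'// dLE; ring.
have JE : J + d *: L k - f *: 'X = ((J + d *: L k - f *: 'X).[0])%:P.
  apply: deriv_eq0; rewrite derivB derivD !derivZ derivX.
  by rewrite -[f *: 1]/(f%:A) alg_polyC dJ.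
set j := (_.[0]) in JE.
(* Likewise the trace mismatches, - d / tau and (-1)^k d / tau, pair like L_(k+1)', still of degree
   at most k. *)
have uE : J + alpha *: u^`() - beta *: u = (alpha * d / tau) *: (L k.+1)^`().
  set c := alpha * d / tau; apply/eqP; rewrite -subr_eq0; apply/eqP.
  apply: (pint_nondegenerate h_gt0 (n := k.+1)).
    rewrite (leq_trans (size_polyD _ _))// geq_max size_polyN.
    rewrite (leq_trans (size_scale_leq _ _))// andbT.
    rewrite (leq_trans (size_polyD _ _))// geq_max size_polyN.
    rewrite [X in _ && X](leq_trans (size_scale_leq _ _))// andbT.
    rewrite (leq_trans (size_polyD _ _))// geq_max sJ.
    rewrite (leq_trans (size_scale_leq _ _))//.
    by rewrite size_deriv_leq// leqW.
  move=> v sv; rewrite 2!mulrBl mulrDl -!scalerAl !pintB pintD !pintZ. 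
  rewrite (pint_deriv_legendre h_gt0 (leqW sv)) exprS {}/c.
  have := cons v sv; rewrite derivZ -scalerAr -scalerAl !pintZ.
  have -> : pint 0 h (u * v^`()) = u.[h] * v.[h] - u.[0] * v.[0] - pint 0 h (u^`() * v).
    by rewrite pint_by_parts; ring.
  have -> : uR = u.[h] - d / tau by rewrite /d; field.
  have -> : uL = u.[0] + (-1) ^+ k * d / tau.
    have -> : (-1) ^+ k * d / tau = - (dL / tau) by rewrite dLE; field.
    by rewrite /dL; field.
  by move=> e; rewrite -[RHS]e; field.
exists j, d, (u - (d / tau) *: L k.+1); split.
- by rewrite subrK.
- by rewrite -JE; ring.
split.
- rewrite linearB linearZ /=.
  have -> : drift u = (alpha * d / tau) *: (L k.+1)^`() - J.
    by rewrite -uE /drift; ring.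
  have -> : J = j%:P + f *: 'X - d *: L k by rewrite -JE; ring.
  by rewrite /drift -!mul_polyC !polyCM; ring.
- rewrite !hornerE legendre_left// exprS.
  have -> : u.[0] = uL - (-1) ^+ k * d / tau.
    have -> : (-1) ^+ k * d / tau = - (dL / tau) by rewrite dLE; field.
    by rewrite /dL; field.
  by field.
- by rewrite !hornerE legendre_right// /d; field.
- by rewrite subrK.
Qed.

Lemma local_form_ends f uL uR j d U : local_form f uL uR j d U ->
  tau * ((U + (d / tau) *: L k.+1).[0] - uL) = - ((-1) ^+ k * d) /\
  tau * ((U + (d / tau) *: L k.+1).[h] - uR) = d.
Proof.
case=> _ <- <- _; rewrite !hornerD !hornerZ legendre_left// legendre_right// exprS.
by split; field.
Qed.

(** The term - d L_k of [J] cancels the stabilization at both ends, which leaves the flux j + f x up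
    to the normal. *)
Lemma local_form_flux f uL uR j d U : local_form f uL uR j d U ->
  flux_left (U + (d / tau) *: L k.+1) (j%:P + f *: 'X - d *: L k) uL = - j /\
  flux_right (U + (d / tau) *: L k.+1) (j%:P + f *: 'X - d *: L k) uR = j + f * h.
Proof.
move=> /local_form_ends[eL eR]; rewrite /flux_left /flux_right eL eR.
by rewrite !hornerE legendre_left// legendre_right//; split; ring.
Qed.

(** Converse of [local_hdg_form]: the same representations of boundary terms, read backwards. *)
Lemma local_form_hdg f uL uR j d U : local_form f uL uR j d U ->
  local_hdg f (U + (d / tau) *: L k.+1) (j%:P + f *: 'X - d *: L k) uL uR.
Proof.
move=> form; have [fL fR] := local_form_flux form.
have [eL eR] := local_form_ends form; case: form => dU UL UR sU.
set u := U + _ in sU eL eR fL fR *; set J := _ - _ in fL fR *.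
split=> //.
- rewrite (leq_trans (size_polyD _ _))// geq_max size_polyN.
  rewrite [X in _ && X](leq_trans (size_scale_leq _ _)) ?size_legendre// andbT.
  rewrite (leq_trans (size_polyD _ _))// geq_max.
  rewrite (leq_trans (size_polyC_leq1 _))//=.
  by rewrite (leq_trans (size_scale_leq _ _))// size_polyX.
- move=> v sv.
  have uE : alpha *: u^`() - beta *: u = (alpha * d / tau) *: (L k.+1)^`() - J.
    rewrite -[LHS]/(drift u) linearD linearZ /= dU /drift /J.
    by rewrite -!mul_polyC !polyCM; ring.
  clearbody J; move: uE; set c := alpha * d / tau.
  move=> /(congr1 (fun p => pint 0 h (p * v))).
  rewrite !mulrBl -!scalerAl !pintB !pintZ (pint_deriv_legendre h_gt0 (leqW sv)).
  rewrite pint_by_parts derivZ -scalerAr !pintZ exprS {}/c.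
  have -> : u.[h] = uR + d / tau by rewrite -[in RHS]eR; field.
  have -> : u.[0] = uL - (-1) ^+ k * d / tau.
    have -> : (-1) ^+ k * d / tau = - (- ((-1) ^+ k * d) / tau) by field.
    by rewrite -eL; field.
  move=> /eqP; rewrite -subr_eq0 => /eqP e.
  by rewrite -[RHS]e; field.
- move=> w sw; rewrite fL fR.
  have := pint_by_parts 0 h J w.
  rewrite {1}/J derivB derivD derivC !derivZ derivX add0r -[f *: 1]/(f%:A) alg_polyC.
  rewrite mulrBl -scalerAl pintB pintZ pint_deriv_legendre// => e.
  have -> : pint 0 h (f%:P * w) = d * (w.[h] - (-1) ^+ k * w.[0])
      + (J.[h] * w.[h] - J.[0] * w.[0] - pint 0 h (J * w^`())).
    by rewrite -e; ring.
  have -> : J.[h] = j + f * h - d by rewrite /J !hornerE legendre_right// mulr1.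
  have -> : J.[0] = j - d * (-1) ^+ k.
    by rewrite /J !hornerE legendre_left// mulr0 addr0.
  by ring.
Qed.

End local_problem.

(** * Solvability of the cell problem for the exact stabilization *)

Section exact_local_problem.
Variables (R : realType) (h alpha beta tau : R) (k : nat) (w Y0 Y1 : {poly R}).
Hypotheses (h_gt0 : 0 < h) (alpha_gt0 : 0 < alpha) (tau_gt0 : 0 < tau).
Hypothesis k_gt0 : (0 < k)%N.

Local Notation L := (legendre h).
Local Notation drift := (drift alpha beta).
Local Notation expjump := (expjump h alpha beta).
Local Notation local_form := (local_form h alpha beta tau k).

Hypothesis drift_w : drift w = L k + (beta / tau) *: L k.+1.
Hypothesis expjump_w : expjump w = 0.
Hypothesis w0 : beta != 0 -> w.[0] != 0.
Hypothesis drift_Y0 : drift Y0 = 1.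
Hypothesis drift_Y1 : drift Y1 = 'X.
Implicit Types (U : {poly R}) (f j d uL uR : R).

Let tn0 : tau != 0. Proof. by rewrite gt_eqF. Qed.

Lemma drift_particular f j d :
  drift (d *: w - (j *: Y0 + f *: Y1)) =
  d *: (L k + (beta / tau) *: L k.+1) - (j%:P + f *: 'X).
Proof.
by rewrite driftB driftD !driftZ drift_w drift_Y0 drift_Y1 alg_polyC.
Qed.

(** The choice of tau enters here: [w] has no jump, so [d] drops out of the relation between the two
    traces. *)
Lemma expjump_particular f j d :
  expjump (d *: w - (j *: Y0 + f *: Y1)) = - (j * expjump Y0 + f * expjump Y1).
Proof. by rewrite expjumpB expjumpD !expjumpZ expjump_w mulr0 sub0r. Qed.

Lemma local_form_jump f uL uR j d U : local_form f uL uR j d U ->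
  expR (- (beta / alpha * h)) * uR - uL = - (j * expjump Y0 + f * expjump Y1).
Proof.
case=> dU <- <- _; rewrite -(expjump_particular f j d).
by apply: expjump_eq => //; rewrite drift_particular.
Qed.

Lemma coef_drift (Q : {poly R}) i :
  (drift Q)`_i = alpha * (Q`_i.+1 *+ i.+1) - beta * Q`_i.
Proof. by rewrite coefB !coefZ coef_deriv. Qed.

(** The difference V vanishes at 0 and its drift is (d - d') times that of [w]. If beta is nonzero,
    V = (d - d') w and w(0) forces d = d'. If beta = 0, the degree bound at order k + 1 and positive
    leading coefficients do. *)
Lemma local_form_unique f uL uR j d d' U U' :
  local_form f uL uR j d U -> local_form f uL uR j d' U' -> d = d' /\ U = U'.
Proof.
case=> dU UL UR sU [dU' UL' UR' sU'].
have e0 : (U - U').[0] = 0 by rewrite !hornerE UL UL' subrr.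
have dV : drift (U - U') = (d - d') *: drift w.
  by rewrite driftB dU dU' drift_w -!mul_polyC polyCB; ring.
have sV : (U - U')`_k.+1 + (d - d') / tau * (L k.+1)`_k.+1 = 0.
  have /leq_sizeP/(_ _ (leqnn _)) := sU.
  have /leq_sizeP/(_ _ (leqnn _)) := sU'.
  rewrite !coefD !coefZ coefN => s' s.
  have := congr2 (fun x y => x - y) s s'; rewrite subrr => e.
  by rewrite -[RHS]e; ring.
suff dd : d - d' = 0.
  split; first by apply/eqP; rewrite -subr_eq0 dd.
  apply/eqP; rewrite -subr_eq0; apply/eqP.
  move: dV; rewrite dd scale0r; have [b0|b0] := eqVneq beta 0.
    rewrite /drift b0 scale0r subr0 => /eqP.
    rewrite scaler_eq0 gt_eqF//= => /eqP/deriv_eq0 ->.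
    by rewrite e0.
  exact: drift_eq0.
have [b0|b0] := eqVneq beta 0; last first.
  have /(drift_eq0 b0) V : drift (U - U' - (d - d') *: w) = 0.
    by rewrite driftB driftZ dV subrr.
  have := congr1 (horner^~ 0) V; rewrite hornerD e0 hornerN hornerZ horner0 add0r.
  by move/eqP; rewrite oppr_eq0 mulf_eq0 (negPf (w0 b0)) orbF => /eqP.
move: dV; rewrite drift_w => /(congr1 (fun p : {poly R} => p`_k)).
rewrite /= coef_drift coefZ b0 !mul0r subr0 scale0r addr0 => Vk.
move: sV; have Lk := legendre_lead_gt0 h_gt0 k.
have Lk1 := legendre_lead_gt0 h_gt0 k.+1.
have -> : (U - U')`_k.+1 = (d - d') * ((L k)`_k / (alpha * k.+1%:R)).
  rewrite mulrA -Vk -[_ *+ k.+1]mulr_natr; field.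
  by rewrite nat1r pnatr_eq0 /= gt_eqF.
rewrite -[(d - d') / tau * _]mulrA -mulrDr => /eqP; rewrite mulf_eq0 => /orP[/eqP //|].
have pos : 0 < (L k)`_k / (alpha * k.+1%:R) + tau^-1 * (L k.+1)`_k.+1.
  by rewrite addr_gt0// ?divr_gt0 ?mulr_gt0 ?invr_gt0 ?ltr0n.
by rewrite gt_eqF.
Qed.

Lemma local_form_exists f uL uR j :
  expR (- (beta / alpha * h)) * uR - uL = - (j * expjump Y0 + f * expjump Y1) ->
  exists d U, local_form f uL uR j d U.
Proof.
move=> jump; pose P d : {poly R} := d *: w - (j *: Y0 + f *: Y1).
(* The jump and the left value determine the right one. *)
have right U : U.[0] = uL -> expjump U = - (j * expjump Y0 + f * expjump Y1) ->
    U.[h] = uR.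
  move=> UL; rewrite -jump /expjump UL => /addIr/mulfI; apply.
  by rewrite gt_eqF// expR_gt0.
have k2 : (L k)`_k.+1 = 0 /\
    (forall i, (k.+1 < i)%N -> (L k)`_i = 0 /\ (L k.+1)`_i = 0).
  split; first by apply/leq_sizeP: (leqnn k.+1); exact: size_legendre.
  move=> i ki; split.
    by move/leq_sizeP : (size_legendre h k); apply; exact: ltnW.
  by move/leq_sizeP : (size_legendre h k.+1); apply.
have jf i : (k < i)%N -> (j%:P + f *: 'X)`_i = 0.
  move=> ki; rewrite coefD coefC coefZ coefX (gtn_eqF (leq_ltn_trans _ ki))//.
  by rewrite (gtn_eqF (leq_ltn_trans _ ki)) ?mulr0 ?addr0.
have rhs d i : (k < i)%N ->
    (d *: (L k + (beta / tau) *: L k.+1) - (j%:P + f *: 'X))`_i =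
    d * ((L k)`_i + beta / tau * (L k.+1)`_i).
  by move=> ki; rewrite coefB jf// subr0 coefZ coefD coefZ.
have [b0|b0] := eqVneq beta 0.
  (* For beta = 0 a constant adjusts the left value, and [d] cancels the coefficient of degree k +
     1, in which it has the positive factor [r]. *)
  pose r := w`_k.+1 + (L k.+1)`_k.+1 / tau.
  have rn0 : r != 0.
    have := congr1 (fun p : {poly R} => p`_k) drift_w.
    rewrite /= coef_drift b0 !mul0r subr0 scale0r addr0 => wk.
    have wk0 : 0 < w`_k.+1.
      rewrite -(pmulrn_lgt0 _ (ltn0Sn k)) -(pmulr_rgt0 _ alpha_gt0) wk.
      exact: legendre_lead_gt0.
    by rewrite gt_eqF// addr_gt0// divr_gt0// legendre_lead_gt0.
  pose d := (j *: Y0 + f *: Y1)`_k.+1 / r.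
  exists d, (P d + (uL - (P d).[0])%:P).
  have dP : drift (P d + (uL - (P d).[0])%:P) = drift (P d).
    by rewrite driftD /drift derivC b0 scaler0 !scale0r !subr0 addr0.
  have PL : (P d + (uL - (P d).[0])%:P).[0] = uL by rewrite hornerD hornerC addrC subrK.
  split=> //.
  - by rewrite dP drift_particular.
  - apply: right => //; rewrite -(expjump_particular f j d).
    exact: expjump_eq.
  - apply/leq_sizeP => i; rewrite leq_eqVlt => /predU1P[<-|ki].
      rewrite !(coefD, coefN, coefZ) coefC addr0.
      transitivity (d * r - (j *: Y0 + f *: Y1)`_k.+1).
        by rewrite /r !(coefD, coefZ); field.
      by rewrite /d mulfVK// subrr.
    case: i ki => // i ki.
    have := congr1 (fun p : {poly R} => p`_i) (drift_particular f j d).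
    rewrite /= coef_drift rhs// b0 !mul0r !subr0 addr0.
    rewrite (leq_sizeP _ _ (size_legendre h k))// mulr0 => /eqP; rewrite mulf_eq0 gt_eqF//= mulrn_eq0 /= => /eqP Pi.
    by rewrite coefD (coefD (P d)) coefC coefZ (k2.2 _ ki).2 mulr0 !addr0.
(* For beta nonzero, [d] fits the left value; the degree bound then follows from the coefficient of
   degree k + 1 of the drift equation. *)
pose d := (uL + (j *: Y0 + f *: Y1).[0]) / w.[0].
exists d, (P d).
have PL : (P d).[0] = uL.
  by rewrite hornerD hornerN hornerZ /d mulfVK ?w0// addrK.
split=> //.
- by rewrite drift_particular.
- by apply: right => //; rewrite expjump_particular.
- have sP : (size (P d) <= k.+2)%N.
    apply: leq_trans (size_drift alpha (P d) b0) _; rewrite drift_particular.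
    apply/leq_sizeP => i ki; have [Li L1i] := k2.2 _ ki.
    by rewrite rhs ?Li ?L1i ?mulr0 ?addr0 ?mulr0// ltnW.
  apply/leq_sizeP => i; rewrite leq_eqVlt => /predU1P[<-|ki]; last first.
    by rewrite coefD coefZ (leq_sizeP _ _ sP)// (k2.2 _ ki).2 mulr0 addr0.
  have := congr1 (fun p : {poly R} => p`_k.+1) (drift_particular f j d).
  rewrite /= coef_drift rhs// k2.1 add0r (leq_sizeP _ _ sP)// mul0rn mulr0 sub0r => e.
  apply: (mulfI b0); rewrite mulr0 coefD coefZ.
  by rewrite mulrDr -[beta * (P d)`_k.+1]opprK e; field.
Qed.

End exact_local_problem.

(** * The recurrence for nodal values with a flux growing by f h per cell *)

Section flux_recurrence.
Variables (R : realType) (e m0 m1 h f : R) (N : nat).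
Hypotheses (e_gt0 : 0 < e) (m0_gt0 : 0 < m0) (N_gt0 : (0 < N)%N).
Implicit Types (x y : nat -> R) (j : R).

(** Here [e] stands for exp (- beta h / alpha), [m0] and [m1] for the jumps of solutions with drift
    1 and x; the flux at node n is j + f h n. *)
Definition flux_recurrence x j : Prop := forall n, (n < N)%N ->
  e * x n.+1 - x n = - ((j + f * h * n%:R) * m0 + f * m1).

(** The response of [x n] to a unit decrease of [j] with [x 0] fixed; as [c N] is positive, the
    right boundary value determines [j]. *)
Let c n : R := iter n (fun t => (t + m0) / e) 0.

Let c_ge0 n : 0 <= c n.
Proof. by elim: n => //= n IH; rewrite divr_ge0 ?addr_ge0// ltW. Qed.

Let cN_gt0 : 0 < c N.
Proof. by rewrite -(prednK N_gt0) /= divr_gt0// ltr_wpDl. Qed.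

Let cS n : e * c n.+1 = c n + m0.
Proof. by rewrite /= mulrC mulfVK// gt_eqF. Qed.

Lemma flux_recurrence_unique x y j j' :
  flux_recurrence x j -> flux_recurrence y j' -> x 0 = y 0 -> x N = y N ->
  j = j' /\ forall n, (n <= N)%N -> x n = y n.
Proof.
move=> fx fy xy0 xyN.
have xy n : (n <= N)%N -> x n - y n = - ((j - j') * c n).
  elim: n => [|n IH] nN; first by rewrite xy0 subrr mulr0 oppr0.
  apply: (mulfI (lt0r_neq0 e_gt0)); rewrite mulrN mulrCA cS.
  have := fx _ nN; have := fy _ nN; have := IH (ltnW nN) => d a b.
  transitivity ((e * x n.+1 - x n) - (e * y n.+1 - y n) + (x n - y n)); first by ring.
  by rewrite a b d; ring.
have jj : j - j' = 0.
  have := xy _ (leqnn N); rewrite xyN subrr => /esym/eqP.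
  by rewrite oppr_eq0 mulf_eq0 (gt_eqF cN_gt0) orbF => /eqP.
split; first by apply/eqP; rewrite -subr_eq0 jj.
by move=> n nN; apply/eqP; rewrite -subr_eq0 xy// jj mul0r oppr0.
Qed.

(** Shooting: [X] starts from [uL] with j = 0, and a multiple of [c] corrects its end value. *)
Lemma flux_recurrence_exists uL uR : exists x j,
  [/\ flux_recurrence x j, x 0 = uL & x N = uR].
Proof.
pose F n t : R := (t - (f * h * n%:R * m0 + f * m1)) / e.
pose X n : R := nat_rect (fun=> R) uL F n.
pose j := (X N - uR) / c N.
exists (fun n => X n - j * c n), j; split.
- move=> n _; rewrite mulrBr (mulrCA e j) cS /= /F.
  by rewrite mulrC mulfVK ?gt_eqF// -/(X n); ring.
- by rewrite mulr0 subr0.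
- by rewrite /j mulfVK ?gt_eqF// opprB addrC subrK.
Qed.

(* a is the coefficient alpha / h * B(- beta h / alpha) of the scheme. *)
Lemma three_point_flux_recurrence a x : a * m0 = 1 ->
  (forall n, (0 < n < N)%N ->
     - (a * x n.-1) + (a * e + a) * x n - a * e * x n.+1 = h * f) <->
  exists j, flux_recurrence x j.
Proof.
move=> am; have an0 : a != 0.
  by apply: contra_eq_neq am => ->; rewrite mul0r eq_sym oner_neq0.
have mn0 : m0 != 0 by rewrite gt_eqF.
(* The scheme is the difference of two consecutive relations, in which [j] and [m1] cancel. *)
have three n : (- (a * x n) + (a * e + a) * x n.+1 - a * e * x n.+2 = h * f) <->
    (e * x n.+2 - x n.+1 = e * x n.+1 - x n - f * h * m0).
  have -> : a = m0^-1 by rewrite -[LHS]mulr1 -(mulfV mn0) mulrA am mul1r.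
  split=> E.
    apply: (mulfI (invr_neq0 mn0)); rewrite [RHS]mulrBr.
    rewrite [m0^-1 * (f * h * m0)]mulrC mulfK//.
    by rewrite [f * h]mulrC -E; ring.
  transitivity (m0^-1 * (e * x n.+1 - x n - (e * x n.+2 - x n.+1))); first by ring.
  by rewrite E; field.
split=> [sg|[j fx] [//|n] nN].
  (* The value of [j] is read off the first cell. *)
  exists (- ((e * x 1 - x 0 + f * m1) / m0)); elim=> [|n IH] nN.
    by field.
  rewrite (three n).1; last exact: (sg n.+1).
  by rewrite IH; [rewrite -nat1r; ring|exact: ltnW].
apply/three; rewrite (fx n.+1)// (fx n); last exact: ltnW.
by rewrite -nat1r; ring.
Qed.

End flux_recurrence.

(** * The Bernoulli coefficients as jumps *)

Section bernoulli.
Variables (R : realType) (h alpha beta : R) (Y0 : {poly R}).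
Hypotheses (h_gt0 : 0 < h) (alpha_gt0 : 0 < alpha).
Hypothesis drift_Y0 : drift alpha beta Y0 = 1.

Local Notation e := (expR (- (beta / alpha * h))).
Local Notation Bm := (bernoulli_fun (- (beta * h / alpha))).
Local Notation Bp := (bernoulli_fun (beta * h / alpha)).

(** The jump depends on the drift alone, so [Y0] may be replaced by x / alpha if beta = 0 and by the
    constant - 1 / beta otherwise. *)
Lemma bernoulli_minus : alpha / h * Bm * expjump h alpha beta Y0 = 1.
Proof.
have hn0 : h != 0 by rewrite gt_eqF.
have an0 : alpha != 0 by rewrite gt_eqF.
rewrite /bernoulli_fun oppr_eq0 !mulf_eq0 invr_eq0 (negPf hn0) (negPf an0) !orbF.
have [b0|b0] := eqVneq beta 0.
  rewrite (expjump_eq h_gt0 alpha_gt0 (q := alpha^-1 *: 'X)); last first.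
    rewrite drift_Y0 /drift b0 scale0r subr0 derivZ derivX scalerA mulfV//.
    by rewrite scale1r.
  rewrite /expjump b0 !hornerZ !hornerX !mul0r oppr0 expR0; field.
  by rewrite hn0 an0.
rewrite (expjump_eq h_gt0 alpha_gt0 (q := (- beta^-1)%:P)); last first.
  rewrite drift_Y0 /drift derivC scaler0 sub0r -mul_polyC -polyCM -polyCN.
  by rewrite mulrN opprK mulfV.
rewrite /expjump !hornerC.
have -> : - (beta * h / alpha) = - (beta / alpha * h) by field.
have e1 : e - 1 != 0.
  rewrite subr_eq0 -expR0 (inj_eq (@expR_inj R)) oppr_eq0.
  by rewrite !mulf_neq0// invr_neq0.
by field; rewrite e1 hn0 an0 b0.
Qed.

Lemma bernoulli_plus : Bp = e * Bm.
Proof.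
have -> : - (beta / alpha * h) = - (beta * h / alpha) by ring.
rewrite /bernoulli_fun oppr_eq0; set x := beta * h / alpha.
have [->|x0] := eqVneq x 0; first by rewrite oppr0 expR0 mul1r.
have e1 : expR x - 1 != 0 by rewrite subr_eq0 -expR0 (inj_eq (@expR_inj R)).
have : expR x != 0 by rewrite gt_eqF// expR_gt0.
rewrite expRN => ex0; field.
by rewrite ex0 e1 mulN1r -oppr_eq0 opprB e1.
Qed.

End bernoulli.

(** * Splitting the method into cell problems and flux continuity *)

Section global_problem.
Variables (R : realType) (alpha beta tau : R) (N k : nat).
Hypotheses (alpha_gt0 : 0 < alpha) (tau_gt0 : 0 < tau).
Hypotheses (N_gt0 : (0 < N)%N) (k_gt0 : (0 < k)%N).

Local Notation h := (N%:R^-1 : R).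
Local Notation nd i := (node R N i).
Local Notation shift i p := (p \Po ('X + (nd i)%:P)).
Local Notation L := (legendre h).
Implicit Types (u J v : broken_poly R N) (uhat mu : vertex_fun R N).

Lemma cell_width_gt0 : 0 < h.
Proof. by rewrite invr_gt0 ltr0n. Qed.

Lemma nodeS i : nd i.+1 = h + nd i.
Proof. by rewrite /node -nat1r mulrDl mul1r. Qed.

Lemma cell_inner_reference (g1 g2 : 'I_N -> {poly R}) :
  cell_inner g1 g2 = \sum_(i < N) pint 0 h (shift i (g1 i) * shift i (g2 i)).
Proof.
apply: eq_bigr => i _; rewrite -comp_polyM pint_compXaddC -nodeS.
rewrite -integral_poly; last by rewrite nodeS ltrDr cell_width_gt0.
by congr Rintegral; apply/funext => x; rewrite hornerM.
Qed.

Lemma face_inner_ends (g1 g2 : 'I_N -> bool -> R) :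
  face_inner g1 g2 = \sum_(i < N) (g1 i false * g2 i false + g1 i true * g2 i true).
Proof. by apply: eq_bigr => i _; rewrite big_bool addrC. Qed.

Lemma trace_left u i : trace u i false = (shift i (u i)).[0].
Proof. by rewrite horner_compXaddC add0r. Qed.

Lemma trace_right u i : trace u i true = (shift i (u i)).[h].
Proof. by rewrite horner_compXaddC -nodeS. Qed.

Lemma hdg_flux_left u J uhat i : hdg_flux tau u J uhat i false =
  flux_left tau (shift i (u i)) (shift i (J i)) (uhat (endpoint i false)).
Proof. by rewrite /hdg_flux !trace_left mulrN1. Qed.

Lemma hdg_flux_right u J uhat i : hdg_flux tau u J uhat i true =
  flux_right h tau (shift i (u i)) (shift i (J i)) (uhat (endpoint i true)).
Proof. by rewrite /hdg_flux !trace_right mulr1. Qed.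

(** A test function supported in one cell isolates the term of that cell. *)
Lemma broken_space_cellwise (F : 'I_N -> {poly R} -> R) : (forall i, F i 0 = 0) ->
  (forall v, broken_space k v -> \sum_(i < N) F i (shift i (v i)) = 0) <->
  (forall i (p : {poly R}), (size p <= k.+1)%N -> F i p = 0).
Proof.
move=> F0; split=> [Fs i p sp|Fi v kv]; last first.
  by apply: big1 => i _; rewrite Fi// size_compXaddC.
pose v : broken_poly R N := [ffun j => if j == i then p \Po ('X - (nd i)%:P) else 0].
have /Fs : broken_space k v.
  move=> j; rewrite ffunE; case: eqP => _; last by rewrite size_poly0.
  by rewrite -polyCN size_compXaddC.
rewrite (bigD1 i)//= big1 ?addr0; first by rewrite ffunE eqxx compXaddCK.
by move=> j /negPf ji; rewrite ffunE ji comp_poly0.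
Qed.

Lemma hdg_cellwise f u J uhat :
  (broken_space k u /\ broken_space k J /\
   (forall v, broken_space k v ->
      cell_inner J v
      - cell_inner u (fun i => (alpha *: v i)^`())
      - cell_inner (fun i => beta *: u i) v
      + face_inner (on_faces uhat) (fun i b => alpha * trace v i b * normal R b)
      = 0) /\
   (forall w : broken_poly R N, broken_space k w ->
      - cell_inner J (fun i => (w i)^`())
      + face_inner (hdg_flux tau u J uhat) (trace w)
      = cell_inner (fun=> f%:P) w)) <->
  (forall i : 'I_N, local_hdg h alpha beta tau k f (shift i (u i)) (shift i (J i))
     (uhat (endpoint i false)) (uhat (endpoint i true))).
Proof.
pose C (i : 'I_N) (p : {poly R}) : R :=
  pint 0 h (shift i (J i) * p) - pint 0 h (shift i (u i) * (alpha *: p)^`())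
  - pint 0 h (beta *: shift i (u i) * p)
  + alpha * (uhat (endpoint i true) * p.[h] - uhat (endpoint i false) * p.[0]).
pose B (i : 'I_N) (p : {poly R}) : R :=
  - pint 0 h (shift i (J i) * p^`())
  + (flux_left tau (shift i (u i)) (shift i (J i)) (uhat (endpoint i false)) * p.[0]
     + flux_right h tau (shift i (u i)) (shift i (J i)) (uhat (endpoint i true)) * p.[h])
  - pint 0 h (f%:P * p).
have CE v : cell_inner J v
      - cell_inner u (fun i => (alpha *: v i)^`())
      - cell_inner (fun i => beta *: u i) v
      + face_inner (on_faces uhat) (fun i b => alpha * trace v i b * normal R b)
      = \sum_(i < N) C i (shift i (v i)).
  rewrite !cell_inner_reference face_inner_ends -!sumrB -big_split /=.
  apply: eq_bigr => i _; rewrite /C trace_left trace_right /on_faces /normal.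
  rewrite -comp_polyZ -deriv_compXaddC -comp_polyZ.
  by congr (_ + _); ring.
have BE (w : broken_poly R N) : - cell_inner J (fun i => (w i)^`())
      + face_inner (hdg_flux tau u J uhat) (trace w) - cell_inner (fun=> f%:P) w
      = \sum_(i < N) B i (shift i (w i)).
  rewrite !cell_inner_reference face_inner_ends -sumrN -big_split -sumrB /=.
  apply: eq_bigr => i _; rewrite /B trace_left trace_right hdg_flux_left hdg_flux_right.
  by rewrite -deriv_compXaddC comp_polyC.
have C0 i : C i 0 = 0.
  by rewrite /C scaler0 derivC !mulr0 !linear0 !horner0 !mulr0; ring.
have B0 i : B i 0 = 0.
  by rewrite /B derivC !mulr0 !linear0 !horner0 !mulr0; ring.
split=> [[su [sJ [cons bal]]] i|loc].
  split; rewrite ?size_compXaddC//.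
  - apply: (broken_space_cellwise C0).1 i => v kv; rewrite -CE; exact: cons.
  - move=> w sw; apply/eqP; rewrite -subr_eq0; apply/eqP; move: w sw.
    apply: (broken_space_cellwise B0).1 i => w kw; by rewrite -BE bal// subrr.
split; [|split; [|split]].
- by move=> i; case: (loc i); rewrite size_compXaddC.
- by move=> i; case: (loc i) => _; rewrite size_compXaddC.
- move=> v kv; rewrite CE; apply: (broken_space_cellwise C0).2 kv => i p sp.
  by case: (loc i) => _ _ + _; exact.
- move=> w kw; apply/eqP; rewrite -subr_eq0 BE; apply/eqP.
  apply: (broken_space_cellwise B0).2 kw => i p sp.
  by rewrite /B; case: (loc i) => _ _ _ ->//; rewrite subrr.
Qed.

Lemma endpoint_left (i : 'I_N) : endpoint i false = inord i.
Proof. by apply: val_inj; rewrite /= inordK// ltnW// ltnS. Qed.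

Lemma endpoint_right (i : 'I_N) : endpoint i true = inord i.+1.
Proof. by apply: val_inj; rewrite /= inordK// ltnS. Qed.

Lemma inord_N : inord N = ord_max :> 'I_N.+1.
Proof. by apply: val_inj; rewrite /= inordK. Qed.

Lemma inord_0 : inord 0 = ord0 :> 'I_N.+1.
Proof. by apply: val_inj; rewrite /= inordK. Qed.

Lemma continuity_flux (F : 'I_N -> bool -> R) :
  (forall mu, mu ord0 = 0 -> mu ord_max = 0 -> face_inner F (on_faces mu) = 0) <->
  (forall i j : 'I_N, j = i.+1 :> nat -> F i true + F j false = 0).
Proof.
split=> [cont i j ij|jump mu mu0 muN].
  (* The indicator of the interior vertex shared by cells [i] and [j]. *)
  pose mu : vertex_fun R N := [ffun n => (n == endpoint j false)%:R].
  have <- : face_inner F (on_faces mu) = F i true + F j false.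
    rewrite face_inner_ends big_split /= addrC; congr (_ + _).
      rewrite (bigD1 i)//= big1 ?addr0 => [|i' ii']; rewrite /on_faces ffunE.
        by rewrite -val_eqE /= ij eqxx mulr1.
      rewrite -val_eqE /= ij /bump /= !add1n eqSS val_eqE (negPf ii') ?mulr0//.
    rewrite (bigD1 j)//= big1 ?addr0 => [|i' ii']; rewrite /on_faces ffunE.
      by rewrite eqxx mulr1.
    by rewrite -val_eqE /= val_eqE (negPf ii') mulr0.
  apply: cont; rewrite ffunE -val_eqE /= ?ij//.
  by rewrite -ij gtn_eqF.
(* Minus the left contribution of cell [n], with default 0 at n = N. Flux continuity and mu = 0 at
   the right boundary make the right contribution of cell [i] equal to [g i.+1], so the sum
   telescopes. *)
pose g n : R := oapp (fun i : 'I_N => - F i false * mu (endpoint i false)) 0 (insub n).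
have -> : face_inner F (on_faces mu) = \sum_(i < N) (g i.+1 - g i).
  rewrite face_inner_ends; apply: eq_bigr => i _; rewrite addrC /g valK /=.
  rewrite mulNr opprK; congr (_ + _); rewrite /on_faces.
  case: insubP => [j _ ij|]; rewrite /= -[lift ord0 i]/(endpoint i true).
    rewrite -[widen_ord _ j]/(endpoint j false).
    have -> : endpoint j false = endpoint i true by apply: val_inj; rewrite /= ij.
    by have /eqP := jump _ _ ij; rewrite addr_eq0 => /eqP ->.
  rewrite -leqNgt => Ni; have -> : endpoint i true = ord_max.
    by apply/val_inj/eqP; rewrite eqn_leq /= /bump /= add1n Ni ltn_ord.
  by rewrite muN mulr0.
rewrite -(big_mkord xpredT (fun i => g i.+1 - g i)) telescope_sumr//.
rewrite /g; case: insubP => [i|_ /=]; first by rewrite ltnn.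
case: insubP => [i _ i0|_]; rewrite /= ?subrr// sub0r.
have -> : widen_ord (leqnSn N) i = ord0 by apply: val_inj.
by rewrite mu0 mulr0 oppr0.
Qed.

End global_problem.

(** * Both schemes as the same flux recurrence *)

Section exact_scheme.
Variables (R : realType) (alpha beta tau : R) (N k : nat) (w Y0 Y1 : {poly R}).
Hypotheses (alpha_gt0 : 0 < alpha) (tau_gt0 : 0 < tau).
Hypotheses (N_gt0 : (0 < N)%N) (k_gt0 : (0 < k)%N).

Local Notation h := (N%:R^-1 : R).
Local Notation L := (legendre h).
Local Notation e := (expR (- (beta / alpha * h))).
Local Notation m0 := (expjump h alpha beta Y0).
Local Notation m1 := (expjump h alpha beta Y1).
Local Notation shift i p := (p \Po ('X + (node R N i)%:P)).
Local Notation local_form := (local_form h alpha beta tau k).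

Hypothesis drift_w : drift alpha beta w = L k + (beta / tau) *: L k.+1.
Hypothesis expjump_w : expjump h alpha beta w = 0.
Hypothesis w0 : beta != 0 -> w.[0] != 0.
Hypothesis drift_Y0 : drift alpha beta Y0 = 1.
Hypothesis drift_Y1 : drift alpha beta Y1 = 'X.
Implicit Types (u J : broken_poly R N) (uhat v : vertex_fun R N).

Let h_gt0 : 0 < h. Proof. exact: cell_width_gt0. Qed.

Lemma m0_gt0 : 0 < m0.
Proof. by apply: expjump_gt0 => // c _; rewrite drift_Y0 hornerC. Qed.

Definition vertex_seq v (n : nat) : R := v (inord n).

Lemma vertex_seq0 v : vertex_seq v 0 = v ord0.
Proof. by rewrite /vertex_seq inord_0. Qed.

Lemma vertex_seqN v : vertex_seq v N = v ord_max.
Proof. by rewrite /vertex_seq inord_N. Qed.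

Lemma vertex_seq_inj v v' :
  (forall n, (n <= N)%N -> vertex_seq v n = vertex_seq v' n) -> v = v'.
Proof.
move=> vv'; apply/ffunP => i.
by have := vv' i (ltn_ord i); rewrite /vertex_seq inord_val.
Qed.

Lemma sg_solutionP f uL uR v : sg_solution alpha beta f uL uR v <->
  [/\ v ord0 = uL, v ord_max = uR &
      exists j, flux_recurrence e m0 m1 h f N (vertex_seq v) j].
Proof.
have am := bernoulli_minus h_gt0 alpha_gt0 drift_Y0.
have P := three_point_flux_recurrence e m1 h f N m0_gt0 (vertex_seq v) am.
have Bp := bernoulli_plus h alpha beta.
split=> [[vL vR bal]|[vL vR /P sg]].
  split=> //; apply/P => n /andP[n0 nN].
  have := bal (inord n); rewrite /= inordK ?ltnS ?(ltnW nN)// n0 nN => /(_ isT).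
  by rewrite Bp => <-; rewrite /vertex_seq; ring.
split=> // i iN /=; have := sg i iN; rewrite Bp => <-.
by rewrite /vertex_seq inord_val; ring.
Qed.

(** One [j] serves all cells: in cell [i] the local constant is the flux at its left node. *)
Definition cell_form f u J uhat j (i : 'I_N) d U : Prop :=
  [/\ shift i (u i) = U + (d / tau) *: L k.+1,
      shift i (J i) = (j + f * h * i%:R)%:P + f *: 'X - d *: L k &
      local_form f (uhat (endpoint i false)) (uhat (endpoint i true))
        (j + f * h * i%:R) d U].

Lemma hdg_solutionP f uL uR u J uhat :
  hdg_solution alpha beta f uL uR k tau u J uhat <->
  [/\ uhat ord0 = uL, uhat ord_max = uR &
      exists j, forall i, exists d U, cell_form f u J uhat j i d U].
Proof.
have flux (jj : 'I_N -> R) (d : 'I_N -> R) (U : 'I_N -> {poly R}) (i : 'I_N) :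
    shift i (u i) = U i + (d i / tau) *: L k.+1 ->
    shift i (J i) = (jj i)%:P + f *: 'X - d i *: L k ->
    local_form f (uhat (endpoint i false)) (uhat (endpoint i true)) (jj i) (d i) (U i) ->
    hdg_flux tau u J uhat i false = - jj i /\
    hdg_flux tau u J uhat i true = jj i + f * h.
  move=> uE JE form; rewrite hdg_flux_left hdg_flux_right// uE JE.
  exact (local_form_flux h_gt0 tau_gt0 form).
split=> [[su sJ uhL uhR cons bal cont]|[uhL uhR [j cells]]].
  have loc := (hdg_cellwise alpha beta tau k N_gt0 f u J uhat).1
    (conj su (conj sJ (conj cons bal))).
  split=> //.
  have /choice[jj] : forall i : 'I_N, exists j, exists d U,
      [/\ shift i (u i) = U + (d / tau) *: L k.+1,
        shift i (J i) = j%:P + f *: 'X - d *: L k &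
        local_form f (uhat (endpoint i false)) (uhat (endpoint i true)) j d U].
    by move=> i; exact (local_hdg_form h_gt0 tau_gt0 k_gt0 (loc i)).
  move=> /choice[d] /choice[U] form.
  have jumps := (continuity_flux _).1 cont.
  (* Continuity at a shared node equates the outflow jj + f h of one cell with the constant of the
     next. *)
  have jjE i : jj i = jj (Ordinal N_gt0) + f * h * i%:R.
    case: i => n nN; elim: n nN => [|n IH] nN.
      by rewrite mulr0 addr0; congr jj; exact: val_inj.
    have := jumps (Ordinal (ltnW nN)) (Ordinal nN) erefl.
    have [uE JE fo] := form (Ordinal nN); have [uE' JE' fo'] := form (Ordinal (ltnW nN)).
    have [-> _] := flux _ _ _ _ uE JE fo; have [_ ->] := flux _ _ _ _ uE' JE' fo'.
    rewrite IH /= => /eqP; rewrite subr_eq0 => /eqP <-.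
    by rewrite -[in RHS]nat1r; ring.
  exists (jj (Ordinal N_gt0)) => i; exists (d i), (U i).
  by rewrite /cell_form -jjE; exact: form.
have /choice[d /choice[U form]] := cells.
have [|su [sJ [cons bal]]] := (hdg_cellwise alpha beta tau k N_gt0 f u J uhat).2.
  by move=> i; have [-> -> fo] := form i; exact (local_form_hdg h_gt0 tau_gt0 k_gt0 fo).
split=> //.
apply: (continuity_flux _).2 => i i' ii'.
have [uE JE fo] := form i; have [uE' JE' fo'] := form i'.
have [_ ->] := flux (fun i => j + f * h * i%:R) _ _ _ uE JE fo.
have [-> _] := flux (fun i => j + f * h * i%:R) _ _ _ uE' JE' fo'.
by rewrite ii' -nat1r; ring.
Qed.

Lemma hdg_flux_recurrence f u J uhat j :
  (forall i, exists d U, cell_form f u J uhat j i d U) ->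
  flux_recurrence e m0 m1 h f N (vertex_seq uhat) j.
Proof.
move=> cells n nN; have [d [U [_ _ form]]] := cells (Ordinal nN).
have := local_form_jump h_gt0 alpha_gt0 drift_w expjump_w drift_Y0 drift_Y1 form.
by rewrite endpoint_left endpoint_right.
Qed.

(** The recurrence fixes [j] and the trace; each cell problem then fixes [u] and [J]. *)
Lemma exact_hdg_unique f uL uR u J uhat u' J' uhat' :
  hdg_solution alpha beta f uL uR k tau u J uhat ->
  hdg_solution alpha beta f uL uR k tau u' J' uhat' ->
  [/\ u = u', J = J' & uhat = uhat'].
Proof.
move=> /hdg_solutionP[uhL uhR [j cells]] /hdg_solutionP[uhL' uhR' [j' cells']].
have [||jj uu] := flux_recurrence_unique (expR_gt0 _) m0_gt0 N_gt0
  (hdg_flux_recurrence cells) (hdg_flux_recurrence cells').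
- by rewrite !vertex_seq0 uhL.
- by rewrite !vertex_seqN uhR.
have uhE := vertex_seq_inj uu.
have cell i : u i = u' i /\ J i = J' i.
  have [d [U [uE JE form]]] := cells i.
  have [d' [U' [uE' JE' form']]] := cells' i.
  move: form'; rewrite -uhE -jj => form'.
  have [dd UU] := local_form_unique h_gt0 alpha_gt0 tau_gt0 drift_w w0 form form'.
  by split; rewrite -[LHS](compXsubCK (node R N i)) -[RHS](compXsubCK (node R N i))
    ?uE ?uE' ?JE ?JE' ?dd ?UU ?jj.
by split=> //; apply/ffunP => i; have [] := cell i.
Qed.

Lemma exact_hdg_exists f uL uR :
  exists u J uhat, hdg_solution alpha beta f uL uR k tau u J uhat.
Proof.
have [x [j [rec xL xR]]] := flux_recurrence_exists m1 h f
  (expR_gt0 (- (beta / alpha * h))) m0_gt0 N_gt0 uL uR.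
pose uhat : vertex_fun R N := [ffun i => x (nat_of_ord i)].
have /choice[d /choice[U form]] : forall i : 'I_N, exists d U,
    local_form f (uhat (endpoint i false)) (uhat (endpoint i true))
      (j + f * h * i%:R) d U.
  move=> i; apply (local_form_exists h_gt0 alpha_gt0 tau_gt0 k_gt0
    drift_w expjump_w w0 drift_Y0 drift_Y1).
  by rewrite !ffunE /= /bump /= add1n; exact: rec.
exists [ffun i : 'I_N => (U i + (d i / tau) *: L k.+1) \Po ('X - (node R N i)%:P)].
exists [ffun i : 'I_N => ((j + f * h * i%:R)%:P + f *: 'X - d i *: L k)
                         \Po ('X - (node R N i)%:P)].
exists uhat; apply/hdg_solutionP; split; rewrite ?ffunE//.
exists j => i; exists (d i), (U i).
by split; [rewrite ffunE compXaddCK|rewrite ffunE compXaddCK|exact: form].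
Qed.

Lemma sg_unique f uL uR v v' : sg_solution alpha beta f uL uR v ->
  sg_solution alpha beta f uL uR v' -> v = v'.
Proof.
move=> /sg_solutionP[vL vR [j rec]] /sg_solutionP[vL' vR' [j' rec']].
have [||_ vv] := flux_recurrence_unique (expR_gt0 _) m0_gt0 N_gt0 rec rec'.
- by rewrite !vertex_seq0 vL.
- by rewrite !vertex_seqN vR.
exact: vertex_seq_inj.
Qed.

Lemma exact_hdg_sg f uL uR u J uhat :
  hdg_solution alpha beta f uL uR k tau u J uhat -> sg_solution alpha beta f uL uR uhat.
Proof.
move=> /hdg_solutionP[uhL uhR [j cells]]; apply/sg_solutionP; split=> //.
by exists j; exact: hdg_flux_recurrence cells.
Qed.

End exact_scheme.

Theorem theorem3p1 (R : realType) (alpha beta : R) (N k : nat)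
    (halpha : 0 < alpha) (hN : (0 < N)%N) (hk : (0 < k)%N) :
  exists tau : R, 0 < tau /\
    forall f uL uR : R,
      [/\ exists! s : broken_poly R N * broken_poly R N * vertex_fun R N,
            hdg_solution alpha beta f uL uR k tau s.1.1 s.1.2 s.2,
          exists! v : vertex_fun R N, sg_solution alpha beta f uL uR v
        & forall (u J : broken_poly R N) (uhat v : vertex_fun R N),
            hdg_solution alpha beta f uL uR k tau u J uhat ->
            sg_solution alpha beta f uL uR v ->
            forall i : 'I_N.+1, uhat i = v i].
Proof.
have h0 := cell_width_gt0 R hN.
have [tau [w [tau0 dw Ew w0]]] := exact_stabilization h0 halpha beta hk.
have [Y0 dY0] := drift_surjective halpha beta 1.
have [Y1 dY1] := drift_surjective halpha beta 'X.
exists tau; split=> // f uL uR.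
have [u [J [uhat sol]]] := exact_hdg_exists halpha tau0 hN hk dw Ew w0 dY0 dY1 f uL uR.
(* Every trace solves the Scharfetter-Gummel scheme, so its existence comes from the method and the
   equality from [sg_unique]. *)
have sg u' J' uhat' := @exact_hdg_sg _ _ _ _ _ _ _ _ _ halpha tau0 hN hk dw Ew
  dY0 dY1 f uL uR u' J' uhat'.
have sgU := sg_unique Y1 halpha hN dY0.
split.
- exists (u, J, uhat); split=> // -[[u' J'] uhat'] /= sol'.
  by have [-> -> ->] := exact_hdg_unique halpha tau0 hN hk dw Ew w0 dY0 dY1 sol sol'.
- by exists uhat; split=> [|v sgv]; [exact: sg sol|exact: sgU (sg _ _ _ sol) sgv].
- by move=> u' J' uhat' v /sg sgu sgv i; rewrite (sgU _ _ _ _ _ sgu sgv).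
Qed.
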